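(* Let $\mathbf{k}$ be a commutative ring, let $k\in\mathbb{N}$, and let $n\geq k$ be an integer. Let $\mathcal{S}$ be the ring of symmetric polynomials in $\mathbf{k}[x_1,\ldots,x_k]$. For each $i\in\{1,2,\ldots,k\}$, let $a_i\in\mathcal{S}$ be a symmetric polynomial of degree $<n-k+i$. Let $I$ be the ideal of $\mathcal{S}$ generated by $h_{n-k+1}-a_1,\ h_{n-k+2}-a_2,\ \ldots,\ h_n-a_k$. Then the family $\left(\overline{m_\lambda}\right)_{\lambda\in P_{k,n}}$ is a basis of the $\mathbf{k}$-module $\mathcal{S}/I$.
   Context: The degree of a polynomial is its total degree; the zero polynomial counts as having degree smaller than every integer. $h_m$ is the $m$-th complete homogeneous symmetric polynomial in $x_1,\ldots,x_k$. For a partition $\lambda$, $m_\lambda=m_\lambda(x_1,\ldots,x_k)\in\mathcal{S}$ is the monomial symmetric polynomial of $\lambda$ (the sum of all distinct monomials $x^\alpha$ where $\alpha\in\mathbb{N}^k$ is a permutation of $(\lambda_1,\ldots,\lambda_k)$, for $\lambda$ with at most $k$ parts). $P_{k,n}$ is the set of all partitions with at most $k$ parts, all of which are $\leq n-k$. $\overline{f}$ denotes the residue class of $f\in\mathcal{S}$ in $\mathcal{S}/I$. *)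

(* Defs.v *)
From HB Require Import structures.
From mathcomp Require Import all_boot all_order all_algebra perm.
From mathcomp.multinomials Require Export mpoly.
From mathcomp Require Import boolp.

Set Implicit Arguments.
Unset Strict Implicit.
Unset Printing Implicit Defensive.

Import GRing.Theory.
Local Open Scope ring_scope.
Local Open Scope quotient_scope.

(* [msize p] is 1 + (total degree of p) if p <> 0, and 0 if p = 0. *)
Definition degree_lt (R : comNzRingType) (k : nat) (p : {mpoly R[k]}) (d : nat) :
  bool := (msize p <= d)%N.

Section SymmetricPolynomials.

Variables (R : comNzRingType) (k : nat).

Record sympoly := Sympoly {
  sympol :> {mpoly R[k]};
  _ : sympol \is symmetric
}.

HB.instance Definition _ := [isSub for sympol].
HB.instance Definition _ := [Choice of sympoly by <:].
HB.instance Definition _ := [SubChoice_isSubComNzRing of sympoly by <:].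
HB.instance Definition _ := [SubZmodule_isSubLmodule of sympoly by <:].
HB.instance Definition _ := [SubNzRing_SubLmodule_isSubLalgebra of sympoly by <:].
HB.instance Definition _ := [SubLalgebra_isSubAlgebra of sympoly by <:].

Lemma sym_mnm_sum (d : nat) (P : pred 'X_{1..k}) :
    (forall m, P m -> (mdeg m < d)%N) ->
    (forall (m : 'X_{1..k}) (s : 'S_k), P [multinom m (s i) | i < k] = P m) ->
  (\sum_(m : 'X_{1..k < d} | P m) 'X_[m] : {mpoly R[k]}) \is symmetric.
Proof.
move=> Pd PS.
pose p := (\sum_(m : 'X_{1..k < d} | P m) 'X_[m] : {mpoly R[k]}).
have pE m : p@_m = (P m)%:R.
  rewrite /p raddf_sum /=; case: (boolP (P m)) => Pm.
    rewrite (bigD1 (BMultinom (Pd m Pm))) //= mcoeffX eqxx big1 ?addr0 //.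
    move=> m' /andP[_ ne]; rewrite mcoeffX.
    by case: eqP => // e; case/eqP: ne; apply: val_inj.
  rewrite big1 // => m' Pm'; rewrite mcoeffX.
  by case: eqP => // e; move: Pm; rewrite -e Pm'.
by apply/issymP => s; apply/mpolyP => m; rewrite mcoeff_sym !pE PS.
Qed.

Definition complete_pol (d : nat) : {mpoly R[k]} :=
  \sum_(m : 'X_{1..k < d.+1} | mdeg m == d) 'X_[m].

Lemma complete_pol_sym d : complete_pol d \is symmetric.
Proof.
apply: (@sym_mnm_sum d.+1 (fun m => mdeg m == d)) => [m /eqP -> //|m s].
by rewrite mdeg_mperm.
Qed.

Definition complete (d : nat) : sympoly := Sympoly (complete_pol_sym d).

(* The degree bound only makes the index set finite: every rearrangement of
   [l] has degree [sumn l]. *)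
Definition monomial_pol (l : k.-tuple nat) : {mpoly R[k]} :=
  \sum_(m : 'X_{1..k < (sumn l).+1} | perm_eq m l) 'X_[m].

Lemma monomial_pol_sym l : monomial_pol l \is symmetric.
Proof.
apply: (@sym_mnm_sum (sumn l).+1 (fun m => perm_eq m l)) => [m ml|m s].
  by rewrite /mdeg (perm_big _ ml) /= sumnE.
suff /permPl -> : perm_eq [multinom m (s i) | i < k] m by [].
by apply/tuple_permP; exists s; congr (val _); apply: eq_from_tnth => i;
  rewrite !tnth_mktuple.
Qed.

Definition monomial (l : k.-tuple nat) : sympoly := Sympoly (monomial_pol_sym l).

End SymmetricPolynomials.

Notation "{ 'sympoly' R [ k ] }" := (sympoly R k)
  (at level 0, R, k at level 2, format "{ 'sympoly'  R [ k ] }").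

(* A partition with at most k parts is padded with zeros to a weakly
   decreasing k-tuple. *)
Definition box_partition (k n : nat) :=
  {l : k.-tuple 'I_(n - k).+1 | sorted geq (map val l)}.

HB.instance Definition _ k n := Finite.on (box_partition k n).

Definition parts (k n : nat) (l : box_partition k n) : k.-tuple nat :=
  map_tuple val (val l).

Section IdealQuotient.

Variables (R : comNzRingType) (S : comAlgType R) (r : nat) (g : 'I_r -> S).

Definition ideal_gen : {pred S} :=
  fun f => `[< exists c : 'I_r -> S, f = \sum_i c i * g i >].

Lemma ideal_genP f :
  reflect (exists c : 'I_r -> S, f = \sum_i c i * g i) (f \in ideal_gen).
Proof. exact: asboolP. Qed.

Lemma ideal_gen_zmod_closed : zmod_closed ideal_gen.
Proof.
split=> [|x y /ideal_genP[c ->] /ideal_genP[d ->]]; apply/ideal_genP.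
  by exists (fun=> 0); rewrite big1 // => i _; rewrite mul0r.
by exists (fun i => c i - d i); rewrite -sumrB; apply: eq_bigr => i _; rewrite mulrBl.
Qed.

HB.instance Definition _ := GRing.isZmodClosed.Build S ideal_gen ideal_gen_zmod_closed.

Lemma ideal_genMl a x : x \in ideal_gen -> a * x \in ideal_gen.
Proof.
case/ideal_genP=> c ->; apply/ideal_genP; exists (fun i => a * c i).
by rewrite mulr_sumr; apply: eq_bigr => i _; rewrite mulrA.
Qed.

(* [{ideal_quot I}] is used rather than the ring structure of the library on
   it, which presupposes that I is a proper ideal. *)
Definition quot_by := {ideal_quot ideal_gen}.

HB.instance Definition _ := GRing.Zmodule.on quot_by.

Definition residue (f : S) : quot_by := \pi_({ideal_quot ideal_gen}) f.

Lemma residueB : {morph residue : x y / x - y}.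
Proof. move=> x y; exact: (raddfB (\pi_({ideal_quot ideal_gen}))). Qed.

Lemma residueD : {morph residue : x y / x + y}.
Proof. move=> x y; exact: (raddfD (\pi_({ideal_quot ideal_gen}))). Qed.

Lemma residue_eq x y : (residue x == residue y) = (x - y \in ideal_gen).
Proof. by rewrite Quotient.idealrBE. Qed.

Definition quot_scale (c : R) (x : quot_by) : quot_by :=
  residue (c *: repr (x : {ideal_quot ideal_gen})).

Lemma residueZ c f : quot_scale c (residue f) = residue (c *: f).
Proof.
apply/eqP; rewrite residue_eq -scalerBr -mulr_algl; apply: ideal_genMl.
by rewrite -residue_eq /residue reprK.
Qed.

Lemma residueP (x : quot_by) : exists f, x = residue f.
Proof. by exists (repr (x : {ideal_quot ideal_gen})); rewrite /residue reprK. Qed.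

Lemma quot_scaleA a b x : quot_scale a (quot_scale b x) = quot_scale (a * b) x.
Proof. by have [f ->] := residueP x; rewrite !residueZ scalerA. Qed.

Lemma quot_scale1 : left_id 1 quot_scale.
Proof. by move=> x; have [f ->] := residueP x; rewrite residueZ scale1r. Qed.

Lemma quot_scaleDr : right_distributive quot_scale +%R.
Proof.
move=> a x y; have [f ->] := residueP x; have [h ->] := residueP y.
by rewrite -residueD !residueZ scalerDr residueD.
Qed.

Lemma quot_scaleDl x : {morph quot_scale^~ x : a b / a + b}.
Proof.
by move=> a b; have [f ->] := residueP x; rewrite !residueZ scalerDl residueD.
Qed.

HB.instance Definition _ := GRing.Zmodule_isLmodule.Build R quot_by
  quot_scaleA quot_scale1 quot_scaleDr quot_scaleDl.

End IdealQuotient.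

Definition is_basis (R : comNzRingType) (M : lmodType R) (I : finType)
    (v : I -> M) : Prop :=
  (forall c : I -> R, \sum_i c i *: v i = 0 -> forall i, c i = 0) /\
  (forall x : M, exists c : I -> R, x = \sum_i c i *: v i).

(* Main.v *)
(* Write N = n - k, w_i = N + i and g_i = h_{w_i} - a_i.  The products
   g^mu m_lambda, with lambda in the box P_{k,n} and mu in N^k, form a basis of
   the R-module S, from which the theorem follows by setting all g_i to 0.

   They span S in a degree-preserving way: if f has leading monomial x^nu, one
   subtracts a multiple of m_nu when nu lies in the box; when nu_1 > N one
   subtracts instead a multiple of the Schur polynomial s_nu, whose leading
   monomial is also x^nu and which lies in the ideal of the h_{w_i}.  Here s_nu is
   obtained as the determinant of the coefficients of the remainders of
   X^(nu_i + k - i) modulo (X - x_1) ... (X - x_k); those of X^p with p >= n are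
   in the ideal of the h_{w_i}.

   They are independent by counting: an explicit injection shows that there are
   at most as many pairs (lambda, mu) with |lambda| + sum mu_i w_i <= d as there
   are partitions of size <= d with at most k parts, and a spanning family of at
   most r elements in a free module of rank r over a commutative ring is a
   basis. *)

Require Import Defs.
From mathcomp Require Import all_boot all_order all_algebra.
From mathcomp Require Import perm zify ring.
From mathcomp.multinomials Require Import mpoly.

Set Implicit Arguments.
Unset Strict Implicit.
Unset Printing Implicit Defensive.

Import Order.TTheory GRing.Theory.
Local Open Scope ring_scope.

(** * Remainders modulo the polynomial with roots x_1, ..., x_k *)

Section Recurrence.
Variables (R : comNzRingType) (k' : nat).
Local Notation k := k'.+1.
Local Notation P := {mpoly R[k]}.

Definition xvar (i : nat) : P := 'X_(inord i).

Definition tail_mnm (r : nat) (m : 'X_{1..k}) : bool :=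
  [forall i : 'I_k, (i < r)%N ==> (m i == 0%N)].

(** This is $h_d(x_r, \ldots, x_{k'})$, with variables numbered from 0. *)
Definition tail_complete (r d : nat) : P :=
  \sum_(m : 'X_{1..k < d.+1} | (mdeg m == d) && tail_mnm r m)
     'X_[m].

Lemma tail_completeE r d (m : 'X_{1..k}) :
  (tail_complete r d)@_m = ((mdeg m == d) && tail_mnm r m)%:R.
Proof.
rewrite /tail_complete raddf_sum /=; case: (boolP (_ && _)) => Pm.
  have dm : (mdeg m < d.+1)%N by case/andP: Pm => /eqP ->.
  rewrite (bigD1 (BMultinom dm)) //= mcoeffX eqxx big1 ?addr0 //.
  move=> m' /andP[_ ne]; rewrite mcoeffX.
  by case: eqP => // e; case/eqP: ne; apply: val_inj.
rewrite big1 // => m' Pm'; rewrite mcoeffX.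
by case: eqP => // e; move: Pm; rewrite -e Pm'.
Qed.

Lemma tail_complete0 d : tail_complete 0 d = complete_pol R k d.
Proof.
by apply: eq_bigl => m; rewrite -[RHS]andbT; congr andb; apply/forallP => i.
Qed.

Lemma tail_complete_deg0 r : tail_complete r 0 = 1.
Proof.
apply/mpolyP => m; rewrite tail_completeE mcoeff1 mdeg_eq0.
case: eqP => //= ->; suff -> : tail_mnm r 0%MM by [].
by apply/forallP => i; rewrite mnm0E eqxx implybT.
Qed.

Lemma tail_complete_full d : tail_complete k d.+1 = 0.
Proof.
apply/mpolyP => m; rewrite tail_completeE mcoeff0.
case: (boolP (tail_mnm _ _)) => [/forallP H|_]; rewrite ?andbF //.
suff -> : m = 0%MM by rewrite mdeg0.
by apply/mnmP => i; move/implyP: (H i) => /(_ (ltn_ord i))/eqP ->; rewrite mnm0E.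
Qed.

(** A monomial of degree $d+1$ either contains $x_r$, which is then divided out, or involves later
    variables only. *)
Lemma tail_completeS r d : (r < k)%N ->
  tail_complete r d.+1 = xvar r * tail_complete r d + tail_complete r.+1 d.+1.
Proof.
move=> rk; apply/mpolyP => m; rewrite mcoeffD mulrC !tail_completeE.
pose j : 'I_k := inord r; have jE : j = r :> nat by rewrite inordK.
have split_r : tail_mnm r.+1 m =
   tail_mnm r m && (m j == 0%N).
  apply/forallP/andP => [H|[/forallP H mj] i].
    split; last by move/implyP: (H j); apply; rewrite jE.
    by apply/forallP => i; apply/implyP => ir; move/implyP: (H i); apply; apply: ltnW.
  apply/implyP; rewrite ltnS leq_eqVlt => /orP[/eqP ir|]; last exact/implyP.
  by have -> : i = j by apply: val_inj; rewrite /= ir jE.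
rewrite split_r; case: (posnP (m j)) => [mj0|mj].
  rewrite andbT.
  suff -> : (tail_complete r d * xvar r)@_m = 0 by rewrite add0r.
  apply: memN_msupp_eq0; rewrite /xvar -/j (perm_mem (msuppMX _ _)).
  apply/mapP => -[m' _ mE]; move: mj0; rewrite mE mnmDE mnm1E eqxx; lia.
rewrite !andbF addr0.
have Um : (U_(j) <= m)%MM by rewrite lep1mP -lt0n.
rewrite -[in RHS](submK Um) addmC mcoeffMX tail_completeE.
congr (nat_of_bool _)%:R; congr andb.
  by rewrite -{1}(submK Um) mdegD mdeg1 addn1 eqSS.
apply: eq_forallb => i; rewrite mnmBE mnm1E; case: (j =P i) => [<-|_]; last by rewrite subn0.
by rewrite jE ltnn.
Qed.

(* The complete homogeneous polynomials, shifted so that multiplication by 'X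
   on {poly P} becomes the shift of the sequence. *)
Definition shifted_complete (r p : nat) : P :=
  if (p + r < k')%N then 0 else tail_complete r (p + r - k').

(** The [P]-linear functional with ['X^j] mapped to $h_{j+r-k'}(x_r, \ldots, x_{k'})$, read as 0 for
    a negative index. *)
Definition complete_eval (r : nat) (q : {poly P}) : P :=
  \sum_(j < size q) q`_j * shifted_complete r j.

Lemma complete_evalE r (q : {poly P}) d : (size q <= d)%N ->
  complete_eval r q = \sum_(j < d) q`_j * shifted_complete r j.
Proof.
move=> sq; rewrite /complete_eval (big_ord_widen d (fun j => q`_j * shifted_complete r j) sq).
rewrite big_mkcond; apply: eq_bigr => j _; case: ltnP => // le.
by rewrite nth_default ?mul0r.
Qed.

Lemma complete_evalD r (q1 q2 : {poly P}) :
  complete_eval r (q1 + q2) = complete_eval r q1 + complete_eval r q2.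
Proof.
pose d := maxn (size q1) (size q2).
rewrite (@complete_evalE r q1 d) ?leq_maxl // (@complete_evalE r q2 d) ?leq_maxr //.
rewrite (@complete_evalE r (q1 + q2) d) ?size_polyD //.
by rewrite -big_split; apply: eq_bigr => j _; rewrite coefD mulrDl.
Qed.

(** The factor $1 - x_r t$ removes $x_r$ from the generating function $\prod_{i \ge r} 1/(1 - x_i
    t)$; the shift by [r] in [shifted_complete] keeps the indices aligned. *)
Lemma complete_eval_XsubC r (q : {poly P}) : (r < k)%N ->
  complete_eval r (('X - (xvar r)%:P) * q) = complete_eval r.+1 q.
Proof.
move=> rk.
have step p : shifted_complete r p.+1 - xvar r * shifted_complete r p = shifted_complete r.+1 p.
  rewrite /shifted_complete addnS addSn.
  case: (ltngtP (p + r).+1 k') => [lt|gt|eq].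
  - by rewrite mulr0 subr0.
  - by rewrite subSn // tail_completeS // addrAC subrr add0r.
  (* Boundary case: the term multiplied by $x_r$ has negative index, and both remaining terms are
     $h_0 = 1$. *)
  have -> : ((p + r).+1 - k' = 0)%N by rewrite eq subnn.
  by rewrite mulr0 subr0 !tail_complete_deg0.
rewrite (@complete_evalE _ _ (size q).+1); last first.
  apply: leq_trans (size_polyMleq _ _) _.
  by rewrite size_XsubC.
rewrite {1}/complete_eval.
under eq_bigr => j _ do rewrite mulrBl coefB mulrBl coefXM coefCM.
rewrite big_split /= big_ord_recl /= mul0r add0r sumrN big_ord_recr /=.
rewrite [q`_(size q)]nth_default // mulr0 mul0r addr0 -sumrB.
by apply: eq_bigr => j _; rewrite /bump /= add1n -step; ring.
Qed.

Definition root_poly : {poly P} := \prod_(0 <= i < k) ('X - (xvar i)%:P).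

(** Each factor of [root_poly] removes one variable; what is left are the $h_{j+1}$ in no variables,
    which vanish. *)
Lemma complete_eval_root (q : {poly P}) : complete_eval 0 (root_poly * q) = 0.
Proof.
have H r : (r <= k)%N ->
    complete_eval 0 (\prod_(0 <= i < r) ('X - (xvar i)%:P) * q) = complete_eval r q.
  elim: r q => [|r IH] q rk; first by rewrite big_geq ?mul1r.
  by rewrite big_nat_recr //= -mulrA IH ?complete_eval_XsubC // ltnW.
rewrite H // /complete_eval big1 // => j _.
rewrite /shifted_complete ltnNge ltnW ?ltnS ?leq_addl //= addnS subSn ?leq_addl //.
by rewrite tail_complete_full mulr0.
Qed.

Lemma size_root_poly : size root_poly = k.+1.
Proof.
by rewrite /root_poly big_mkord size_prod_XsubC /index_enum -enumT size_enum_ord.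
Qed.

Lemma root_poly_monic : root_poly \is monic.
Proof. exact: monic_prod_XsubC. Qed.

Lemma root_poly_sym j : root_poly`_j \is symmetric.
Proof.
apply/issymP => s; rewrite -coef_map /root_poly big_mkord rmorph_prod /=.
congr ((polyseq _)`_j); rewrite [RHS](reindex_inj (@perm_inj _ s)) /=.
apply: eq_bigr => i _; rewrite rmorphB /= map_polyX map_polyC /= /xvar !inord_val.
rewrite msymX; congr ('X - ('X_[_])%:P); apply/mnmP => l.
by rewrite mnmE !mnm1E -(inj_eq (@perm_inj _ s)) permKV.
Qed.

Lemma root_polyE (l : 'I_k) : root_poly.['X_l] = 0.
Proof.
rewrite /root_poly big_mkord (bigD1 l) //= hornerM hornerXsubC.
by rewrite /xvar inord_val subrr mul0r.
Qed.

(* [xpow_mod p] is the remainder of ['X^p] modulo [root_poly]. *)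
Definition xpow_mod (p : nat) : {poly P} :=
  iter p (fun r => 'X * r - r`_k' *: root_poly) 1.

Lemma xpow_modS p :
  xpow_mod p.+1 = 'X * xpow_mod p - (xpow_mod p)`_k' *: root_poly.
Proof. by []. Qed.

Lemma size_xpow_mod p : (size (xpow_mod p) <= k)%N.
Proof.
elim: p => [|p IH]; first by rewrite size_poly1.
apply/leq_sizeP => j; rewrite leq_eqVlt xpow_modS coefB coefXM coefZ => /orP[/eqP <-|kj] /=.
  have := root_poly_monic; rewrite monicE lead_coefE size_root_poly => /eqP ->.
  by rewrite mulr1 subrr.
case: j kj => // j kj /=.
have -> : root_poly`_j.+1 = 0 by rewrite nth_default // size_root_poly.
by rewrite mulr0 subr0 nth_default // (leq_trans IH).
Qed.

Lemma xpow_modP p : exists q, 'X^p = root_poly * q + xpow_mod p.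
Proof.
elim: p => [|p [q IH]]; first by exists 0; rewrite mulr0 add0r expr0.
exists ('X * q + ((xpow_mod p)`_k')%:P).
rewrite exprS IH xpow_modS -mul_polyC.
move: (xpow_mod p) => r; ring.
Qed.

Lemma xpow_mod_sym p j : (xpow_mod p)`_j \is symmetric.
Proof.
elim: p j => [|p IH] j; first by rewrite coef1 rpred_nat.
rewrite xpow_modS coefB coefXM coefZ rpredB ?rpredM ?root_poly_sym //.
by case: eqP; rewrite ?rpred0.
Qed.

Lemma xpow_modE p (l : 'I_k) : 'X_l ^+ p = (xpow_mod p).['X_l].
Proof.
have [q /(congr1 (horner^~ 'X_l))] := xpow_modP p.
by rewrite hornerD hornerM root_polyE mul0r add0r hornerXn.
Qed.

(** The functional is applied to $X^p X^j$ with $X^p$ replaced by its remainder, since multiples of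
    [root_poly] are killed. *)
Lemma shifted_complete_mod p j :
  shifted_complete 0 (p + j) = \sum_(q < k) (xpow_mod p)`_q * shifted_complete 0 (q + j).
Proof.
have evX m : complete_eval 0 'X^m = shifted_complete 0 m.
  rewrite (@complete_evalE _ _ m.+1) ?size_polyXn // big_ord_recr /= big1 ?add0r.
    by rewrite coefXn eqxx mul1r.
  by move=> i _; rewrite coefXn ltn_eqF ?mul0r.
rewrite -evX exprD; have [q ->] := xpow_modP p.
rewrite mulrDl -mulrA complete_evalD complete_eval_root add0r.
rewrite (@complete_evalE _ _ (j + k)).
  rewrite big_split_ord /= big1 ?add0r => [|i _]; last by rewrite coefMXn ltn_ord mul0r.
  by apply: eq_bigr => i _; rewrite coefMXn ltnNge leq_addr /= addKn addnC.
apply: leq_trans (size_polyMleq _ _) _; rewrite size_polyXn addnS /= addnC leq_add2l.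
exact: size_xpow_mod.
Qed.

End Recurrence.

(** * Schur polynomials in the ideal of complete homogeneous polynomials *)

Section CompleteIdeal.
Variables (R : comNzRingType) (k N : nat).
Local Notation P := {mpoly R[k]}.

Definition in_complete_ideal (f : P) : Prop :=
  exists2 c : 'I_k -> P, (forall i, c i \is symmetric) &
    f = \sum_i c i * complete_pol R k (N + i.+1).

Lemma complete_ideal0 : in_complete_ideal 0.
Proof.
exists (fun=> 0); first by move=> i; apply: rpred0.
by rewrite big1 // => i _; rewrite mul0r.
Qed.

Lemma complete_idealD f1 f2 :
  in_complete_ideal f1 -> in_complete_ideal f2 -> in_complete_ideal (f1 + f2).
Proof.
move=> [c1 sc1 ->] [c2 sc2 ->]; exists (fun i => c1 i + c2 i).
  by move=> i; rewrite rpredD.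
by rewrite -big_split; apply: eq_bigr => i _; rewrite mulrDl.
Qed.

Lemma complete_idealM s f :
  s \is symmetric -> in_complete_ideal f -> in_complete_ideal (s * f).
Proof.
move=> ss [c sc ->]; exists (fun i => s * c i).
  by move=> i; rewrite rpredM.
by rewrite mulr_sumr; apply: eq_bigr => i _; rewrite mulrA.
Qed.

Lemma complete_idealB f1 f2 :
  in_complete_ideal f1 -> in_complete_ideal f2 -> in_complete_ideal (f1 - f2).
Proof.
move=> If1 If2; rewrite -[- f2]mulN1r; apply: complete_idealD => //.
by apply: complete_idealM => //; rewrite rpredN rpred1.
Qed.

Lemma complete_ideal_sum (I : finType) (Q : pred I) (F : I -> P) :
  (forall i, Q i -> in_complete_ideal (F i)) -> in_complete_ideal (\sum_(i | Q i) F i).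
Proof.
by move=> IF; elim/big_ind: _; [apply: complete_ideal0 | apply: complete_idealD | ].
Qed.

Lemma complete_ideal_gen (i : 'I_k) : in_complete_ideal (complete_pol R k (N + i.+1)).
Proof.
exists (fun j => (j == i)%:R); first by move=> j; rewrite rpred_nat.
rewrite (bigD1 i) //= eqxx mul1r big1 ?addr0 // => j /negbTE ->.
by rewrite mul0r.
Qed.

End CompleteIdeal.

Section Alternants.
Variables (R : comNzRingType) (k' : nat).
Local Notation k := k'.+1.
Local Notation P := {mpoly R[k]}.

(** Beyond $p = N + k$ the recurrence for remainders suffices. At $p = N + k$ the relations of
    [shifted_complete_mod] for $j = 0, \ldots, k'$ form a unitriangular system in the coefficients
    of the remainder, with left-hand sides $h_{N+j+1}$. *)
Lemma xpow_mod_complete_ideal N p q : (N + k <= p)%N ->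
  in_complete_ideal N (xpow_mod R k' p)`_q.
Proof.
move/subnK <-; elim: (p - _)%N q => [|m IH] q; last first.
  rewrite addSn xpow_modS coefB coefXM coefZ; apply: complete_idealB.
    by case: eqP => _ //; apply: complete_ideal0.
  by rewrite mulrC; apply: complete_idealM => //; apply: root_poly_sym.
rewrite add0n; case: (leqP k q) => [kq|].
  rewrite nth_default; first exact: complete_ideal0.
  by apply: leq_trans kq; apply: size_xpow_mod.
rewrite ltnS => /subKn <-; move: (k' - q)%N (leq_subr q k') => j.
elim/ltn_ind: j => j IH jk.
have jlt : (k' - j < k)%N by rewrite ltnS leq_subr.
have sc0 m : (m < k')%N -> shifted_complete R k' 0 m = 0.
  by rewrite /shifted_complete addn0 => ->.
(* In the [j]-th relation the coefficient of $X^{k'-j}$ is multiplied by $h_0 = 1$ and the lower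
   ones by 0; the higher ones are in the ideal by induction. *)
have := shifted_complete_mod R k' (N + k) j.
rewrite (bigD1 (Ordinal jlt)) //= subnK //.
have -> : shifted_complete R k' 0 k' = 1.
  by rewrite /shifted_complete addn0 ltnn subnn tail_complete_deg0.
rewrite mulr1 => E; rewrite -[_`__](addrK (\sum_(i < k | i != Ordinal jlt)
  (xpow_mod R k' (N + k))`_i * shifted_complete R k' 0 (i + j))) -E.
apply: complete_idealB.
  rewrite /shifted_complete addn0 ifF ?tail_complete0; last by apply/negbTE; lia.
  have jk1 : (j < k)%N by lia.
  have := complete_ideal_gen R N (Ordinal jk1); rewrite /=.
  by have -> : (N + j.+1 = N + k + j - k')%N by lia.
apply: complete_ideal_sum => i ne; case: (ltnP (i + j) k') => [lt|ge].
  by rewrite sc0 // mulr0; apply: complete_ideal0.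
rewrite mulrC; apply: complete_idealM.
  rewrite /shifted_complete; case: ifP => _; first exact: rpred0.
  by rewrite tail_complete0; apply: complete_pol_sym.
have ine : (i : nat) != (k' - j)%N by apply: contra ne => /eqP e; apply/eqP/val_inj.
have ik := ltn_ord i.
have -> : (i : nat) = (k' - (k' - i))%N by lia.
by apply: IH; lia.
Qed.

Definition alternant (m : 'I_k -> nat) : P :=
  \det (\matrix_(i, l) ('X_l ^+ m i : P)).

(** For $m_i = \lambda_i + k' - i$ this is the Schur polynomial $s_\lambda$, obtained without
    dividing alternants. The columns are reversed to match [staircase]. *)
Definition schur_det (m : 'I_k -> nat) : P :=
  \det (\matrix_(i, j) ((xpow_mod R k' (m i))`_(k' - j) : P)).

Definition staircase (i : 'I_k) : nat := (k' - i)%N.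

(** Evaluating the remainders at $x_l$ factors the matrix of powers into the matrix of remainder
    coefficients and a Vandermonde matrix. *)
Lemma schur_det_alternant m : alternant m = schur_det m * alternant staircase.
Proof.
rewrite /alternant /schur_det -det_mulmx; congr (\det _).
apply/matrixP => i l; rewrite !mxE xpow_modE (horner_coef_wide _ (size_xpow_mod R k' _)).
rewrite (reindex_inj rev_ord_inj) /=; apply: eq_bigr => j _.
by rewrite !mxE /staircase subSS.
Qed.

(** In the expansion along the first row the entries lie in the ideal and the cofactors are
    symmetric. *)
Lemma schur_det_complete_ideal N m : (N + k <= m ord0)%N ->
  in_complete_ideal N (schur_det m).
Proof.
move=> Nm; rewrite /schur_det (expand_det_row _ ord0).
apply: complete_ideal_sum => j _; rewrite mulrC; apply: complete_idealM.
  rewrite /cofactor rpredM ?rpred_sign // /determinant rpred_sum // => s _.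
  rewrite rpredM ?rpred_sign // rpred_prod // => i _; rewrite !mxE.
  exact: xpow_mod_sym.
by rewrite mxE; apply: xpow_mod_complete_ideal.
Qed.

(** Strict decrease of [m] makes the diagonal term of the Leibniz expansion the strictly largest
    one. *)
Lemma alternant_mlead (m : 'X_{1..k}) :
    (forall i j : 'I_k, (i < j)%N -> (m j < m i)%N) ->
  mlead (alternant m) = m /\ mleadc (alternant m) = 1.
Proof.
move=> dec.
have inj_m : injective m.
  move=> i j e; apply/eqP; case: (ltngtP i j) => [/dec|/dec|/val_inj ->//];
    by rewrite e ltnn.
have altE : alternant m = \sum_(s : 'S_k) (-1) ^+ s *: 'X_[[multinom m (s^-1%g i) | i < k]].
  apply: eq_bigr => s _; rewrite -[RHS]mul_mpolyC rmorphXn rmorphN1; congr (_ * _).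
  by rewrite (mpolyXE _ s); apply: eq_bigr => i _; rewrite !mxE mnmE permK.
have mult1 : [multinom m ((1 : 'S_k)%g i) | i < k] = m.
  by apply/mnmP => i; rewrite mnmE perm1.
have lt_perm (s : 'S_k) : s != 1%g -> ([multinom m (s i) | i < k] < m)%O.
  move=> ns; apply/ltmcP; first by rewrite mdeg_mperm.
  have [i0 Pi0] : exists i, s i != i.
    apply/existsP; apply: contraR ns; rewrite negb_exists => /forallP H.
    by apply/eqP/permP => i; rewrite perm1; apply/eqP; rewrite -[_ == _]negbK H.
  (* At the first index [i] moved by [s] one has [s i > i], so the exponent drops there while the
     earlier exponents agree. *)
  case: (@arg_minnP _ i0 (fun i => s i != i) (fun i : 'I_k => i : nat) Pi0) => i si min_i.
  have fixj (j : 'I_k) : (j < i)%N -> s j = j.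
    by move=> ji; apply/eqP; apply: contraTT ji => /min_i; rewrite -leqNgt.
  exists i => [j ji|]; rewrite mnmE; first by rewrite fixj.
  apply: dec; rewrite ltn_neqAle eq_sym (inj_eq val_inj) si leqNgt.
  apply/negP => /fixj /perm_inj e; by rewrite e eqxx in si.
have mc : (alternant m)@_m = 1.
  rewrite altE raddf_sum /= (bigD1 (1%g : 'S_k)) //= invg1 mult1 big1 ?addr0.
    by rewrite odd_perm1 expr0 scale1r mcoeffX eqxx.
  move=> s; rewrite -invg_eq1 => /lt_perm lt; rewrite mcoeffZ mcoeffX.
  case: eqP => [e|_]; last by rewrite mulr0.
  by move: lt; rewrite e ltxx.
suff E : mlead (alternant m) = m by rewrite E.
apply/le_anti/andP; split; last first.
  by apply: msupp_le_mlead; rewrite mcoeff_msupp mc oner_eq0.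
rewrite altE; apply: le_trans (mlead_sum_le _ _ _) _.
apply/joinsP => s _.
apply: le_trans (mleadZ_le _ _) _; rewrite mleadXm.
by have [->|/lt_perm/ltW//] := eqVneq (s^-1)%g (1%g : 'S_k); rewrite mult1.
Qed.

End Alternants.

(** * Homogeneous components and leading monomials of Schur polynomials *)

Lemma mcoeff_pihomog (n : nat) (R : nzRingType) d (p : {mpoly R[n]}) m :
  (pihomog mdeg d p)@_m = if mdeg m == d then p@_m else 0.
Proof.
rewrite pihomogE raddf_sum /= big_mkcond /= [in RHS](mpolyE p) raddf_sum /=.
case: ifP => [/eqP <-|ne].
  apply: eq_bigr => m' _; rewrite !mcoeffZ mcoeffX.
  by case: (m' =P m) => [->|_]; rewrite ?eqxx // mulr0; case: ifP.
apply: big1 => m' _; case: ifP => // e; rewrite mcoeffZ mcoeffX.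
by case: (m' =P m) => [E|_]; [rewrite -E e in ne | rewrite mulr0].
Qed.

Lemma msize_pihomog (n : nat) (R : nzRingType) d (p : {mpoly R[n]}) :
  (msize (pihomog mdeg d p) <= d.+1)%N.
Proof.
rewrite msizeE; apply/bigmax_leqP_seq => m; rewrite mcoeff_msupp mcoeff_pihomog.
by case: ifP => [/eqP -> //|_]; rewrite eqxx.
Qed.

Lemma pihomogMhomog (n : nat) (R : comNzRingType) d w (c h : {mpoly R[n]}) :
  h \is w.-homog ->
  pihomog mdeg d (c * h) = (if (w <= d)%N then pihomog mdeg (d - w) c else 0) * h.
Proof.
(* [K] also exceeds $d - w$, so that the component of this degree occurs in the decomposition of
   [c]. *)
move=> hh; pose K := maxn (msize c) d.+1.
rewrite {1}[c](@pihomog_partitionE _ _ mdeg K) ?leq_maxl //.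
rewrite mulr_suml raddf_sum /=.
have homM e : pihomog mdeg e c * h \is (e + w).-homog.
  by apply: dhomogM => //; apply: pihomogP.
have zero (e : nat) : (e + w)%N != d -> pihomog mdeg d (pihomog mdeg e c * h) = 0.
  by move=> ne; apply: pihomog_ne0 (homM e).
case: leqP => wd; last by rewrite mul0r big1 // => e _; apply: zero; lia.
have dK : (d - w < K)%N by rewrite (leq_ltn_trans (leq_subr _ _)) // leq_max ltnSn orbT.
rewrite (bigD1 (Ordinal dK)) //= big1 ?addr0.
  by rewrite -{1}(subnK wd) pihomog_dE.
move=> e ne; apply: zero; apply: contra ne => /eqP E.
by apply/eqP/val_inj; rewrite /= -E addnK.
Qed.

Lemma complete_pol_homog (R : comNzRingType) k d : complete_pol R k d \is d.-homog.
Proof. by apply: rpred_sum => m md; rewrite dhomogX. Qed.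

(** The leading coefficient 1 of [q] is not a zero divisor, so leading monomials add although [R]
    may have zero divisors. *)
Lemma monic_factor_mlead (n : nat) (R : nzRingType) (p q s : {mpoly R[n]}) m :
    p = s * q -> mlead p = (m + mlead q)%MM -> mleadc p = 1 -> mleadc q = 1 ->
  mlead s = m /\ mleadc s = 1.
Proof.
move=> E lp cp cq; have nzs : s != 0.
  by apply/eqP => s0; move: cp; rewrite E s0 mul0r mcoeff0 => /esym/eqP; rewrite oner_eq0.
have pr : mleadc s * mleadc q != 0 by rewrite cq mulr1 mleadc_eq0.
split; first by have := mleadM_proper pr; rewrite -E lp => /addIm.
by have := mleadcM_proper pr; rewrite -E cp cq mulr1.
Qed.

Section Schur.
Variables (R : comNzRingType) (k' : nat).
Local Notation k := k'.+1.

(** The Schur polynomial is the quotient of the alternants of $m + \delta$ and $\delta$, with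
    leading terms $x^{m+\delta}$ and $x^\delta$. *)
Lemma schur_det_mlead (m : 'X_{1..k}) :
    (forall i j : 'I_k, (i <= j)%N -> (m j <= m i)%N) ->
  let s := schur_det R (fun i => m i + staircase i)%N in
  mlead s = m /\ mleadc s = 1.
Proof.
move=> dec s.
pose d := [multinom @staircase k' i | i < k].
have dE i : d i = (k' - i)%N by rewrite mnmE.
have [ld cd] : mlead (alternant R d) = d /\ mleadc (alternant R d) = 1.
  by apply: alternant_mlead => i j ij; rewrite !dE; have := ltn_ord j; lia.
have [lm cm] : mlead (alternant R (m + d)%MM) = (m + d)%MM /\
               mleadc (alternant R (m + d)%MM) = 1.
  apply: alternant_mlead => i j ij; rewrite !mnmDE !dE.
  by have := ltn_ord j; have := dec i j (ltnW ij); lia.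
have E : alternant R (m + d)%MM = s * alternant R d.
  have -> : alternant R d = alternant R (@staircase k').
    by congr (\det _); apply/matrixP => i j; rewrite !mxE mnmE.
  rewrite /s -schur_det_alternant; congr (\det _); apply/matrixP => i j.
  by rewrite !mxE mnmDE mnmE.
by apply: (monic_factor_mlead E) => //; rewrite ld.
Qed.
End Schur.

(** Membership of the Schur polynomial in the ideal does not bound the degrees of the coefficients.
    Its component of degree $|m|$ keeps the leading term and truncates each coefficient to the right
    degree. *)
Lemma dominant_complete_ideal (R : comNzRingType) k N (m : 'X_{1..k}) (i0 : 'I_k) :
    (forall i j : 'I_k, (i <= j)%N -> (m j <= m i)%N) -> (N < m i0)%N ->
  exists c : 'I_k -> {mpoly R[k]},
    [/\ forall i, c i \is symmetric,
        forall i, c i != 0 -> (msize (c i) + (N + i.+1) <= (mdeg m).+1)%N,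
        mlead (\sum_i c i * complete_pol R k (N + i.+1)) = m
      & mleadc (\sum_i c i * complete_pol R k (N + i.+1)) = 1].
Proof.
case: k m i0 => [|k'] m i0 dec Nm; first by case: i0 Nm.
have [] := schur_det_mlead R dec.
set s := schur_det _ _ => ls cs.
have [|c sc sE] := @schur_det_complete_ideal R k' N (fun i => m i + staircase i)%N.
  by rewrite /staircase subn0 addnS -addSn leq_add2r (leq_trans Nm) ?dec.
rewrite -/s in sE.
pose d := mdeg m.
pose c' (i : 'I_k'.+1) := if (N + i.+1 <= d)%N then pihomog mdeg (d - (N + i.+1)) (c i) else 0.
have E : \sum_(i < k'.+1) c' i * complete_pol R _ (N + i.+1) = pihomog mdeg d s.
  rewrite sE raddf_sum /=; apply: eq_bigr => i _.
  by rewrite (pihomogMhomog _ _ (complete_pol_homog R _ _)).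
have cm : (pihomog mdeg d s)@_m = 1 by rewrite mcoeff_pihomog eqxx -cs ls.
have lm : mlead (pihomog mdeg d s) = m.
  have mm : m \in msupp (pihomog mdeg d s) by rewrite mcoeff_msupp cm oner_eq0.
  apply/le_anti; rewrite (msupp_le_mlead mm) andbT -[in X in (_ <= X)%O]ls.
  apply: msupp_le_mlead; rewrite mcoeff_msupp.
  have : mlead (pihomog mdeg d s) \in msupp (pihomog mdeg d s).
    by apply: mlead_supp; apply: contraTneq mm => ->; rewrite msupp0.
  by rewrite mcoeff_msupp mcoeff_pihomog; case: ifP => // _; rewrite eqxx.
exists c'; split.
- by move=> i; rewrite /c'; case: ifP => _; [apply: pihomog_sym | apply: rpred0].
- move=> i; rewrite /c'; case: ifP => [le _|]; last by rewrite eqxx.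
  by have := msize_pihomog (d - (N + i.+1)) (c i); rewrite -/d; lia.
- by rewrite E.
by rewrite E lm.
Qed.

(** * Spanning *)

Definition is_dominant k (m : 'X_{1..k}) : bool := sorted geq m.

Lemma is_dominantP k (m : 'X_{1..k}) :
  reflect (forall i j : 'I_k, (i <= j)%N -> (m j <= m i)%N) (is_dominant m).
Proof.
have tr : transitive geq by move=> x y z /= yx xz; apply: leq_trans xz yx.
apply: (iffP idP) => [srt i j|dec].
  rewrite leq_eqVlt => /orP[/eqP/val_inj -> //|ij].
  rewrite !(mnm_nth 0%N); apply: (sorted_ltn_nth tr) => //;
    by rewrite inE size_tuple.
apply/(sortedP 0%N) => i; rewrite size_tuple => ik.
have := dec (Ordinal (ltnW ik)) (Ordinal ik) (leqnSn i).
by rewrite !(mnm_nth 0%N).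
Qed.

Lemma mcoeff_monomial_pol (R : comNzRingType) k (t : k.-tuple nat) (m : 'X_{1..k}) :
  (monomial_pol R t)@_m = (perm_eq m t)%:R.
Proof.
rewrite raddf_sum /=; case: (boolP (perm_eq m t)) => mt; last first.
  rewrite big1 // => m' m't; rewrite mcoeffX.
  by case: eqP => // e; rewrite -e m't in mt.
have dm : (mdeg m < (sumn t).+1)%N by rewrite /mdeg (perm_big _ mt) /= sumnE.
rewrite (bigD1 (BMultinom dm)) //= mcoeffX eqxx big1 ?addr0 // => m' /andP[_ ne].
rewrite mcoeffX; case: eqP => // e; case/eqP: ne; exact: val_inj.
Qed.

Lemma is_dominant_perm_inj k (m m' : 'X_{1..k}) :
  is_dominant m -> is_dominant m' -> perm_eq m m' -> m = m'.
Proof.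
move=> sm sm' pm; apply/val_inj/val_inj.
apply: (@sorted_eq _ geq) => //; first by move=> x y z /= yx xz; apply: leq_trans xz yx.
by move=> x y /andP[/= xy yx]; apply/eqP; rewrite eqn_leq xy yx.
Qed.

(** The leading monomial of a symmetric polynomial is dominant, and [m] is the only dominant
    rearrangement of itself. *)
Lemma mlead_monomial_pol (R : comNzRingType) k (m : 'X_{1..k}) :
  is_dominant m -> mlead (monomial_pol R m) = m /\ mleadc (monomial_pol R m) = 1.
Proof.
move=> dm; have cm : (monomial_pol R m)@_m = 1 by rewrite mcoeff_monomial_pol perm_refl.
suff lm : mlead (monomial_pol R m) = m by rewrite lm.
have nz : monomial_pol R m != 0.
  by apply/eqP => e; move/eqP: cm; rewrite e mcoeff0 eq_sym oner_eq0.
apply: is_dominant_perm_inj => //.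
  by apply/is_dominantP; apply: mlead_msym_sorted; apply: monomial_pol_sym.
have := mlead_supp nz; rewrite mcoeff_msupp mcoeff_monomial_pol.
by case: (perm_eq _ _) => //; rewrite eqxx.
Qed.

(** The case $f' = 0$ is separate because [mlead 0] is the zero exponent, which is not below that of
    a constant [f]. *)
Lemma mlead_cancel k (R : nzRingType) (f h : {mpoly R[k]}) :
    mlead h = mlead f -> mleadc h = 1 ->
  let f' := f - mleadc f *: h in f' = 0 \/ (mlead f' < mlead f)%O.
Proof.
move=> lh ch f'; have [->|nz] := eqVneq f' 0; first by left.
right; rewrite lt_neqAle; apply/andP; split.
  apply/eqP => e; move: nz; rewrite -mleadc_eq0 e /f' mcoeffB mcoeffZ -[in h@__]lh ch.
  by rewrite mulr1 subrr eqxx.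
apply: le_trans (mleadB_le _ _) _; rewrite leUx lexx /= -lh; exact: mleadZ_le.
Qed.

Lemma msizeM_lt k (R : nzRingType) (p q : {mpoly R[k]}) :
  p * q != 0 -> (msize (p * q) < msize p + msize q)%N.
Proof.
move=> nz; have nzp : p != 0 by apply: contraNneq nz => ->; rewrite mul0r.
have nzq : q != 0 by apply: contraNneq nz => ->; rewrite mulr0.
rewrite -!mlead_deg // addSn addnS !ltnS -mdegD; apply: lemc_mdeg; exact: mleadM_le.
Qed.

Section Span.
Variables (R : comNzRingType) (k n : nat).
Local Notation P := {mpoly R[k]}.
Local Notation N := (n - k)%N.

Variable a : 'I_k -> P.
Hypothesis sym_a : forall i, a i \is symmetric.
Hypothesis deg_a : forall i : 'I_k, (msize (a i) <= N + i.+1)%N.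

Definition box_mnm (l : box_partition k n) : 'X_{1..k} := Multinom (parts l).

Lemma box_mnm_le l i : (box_mnm l i <= N)%N.
Proof.
by rewrite multinomE tnth_map -ltnS ltn_ord.
Qed.

Lemma box_mnm_surj (m : 'X_{1..k}) :
  is_dominant m -> (forall i, m i <= N)%N -> exists l, box_mnm l = m.
Proof.
move=> dm mN; pose t : k.-tuple 'I_N.+1 := [tuple inord (m i) | i < k].
have tE : map val t = m.
  rewrite -[RHS](map_tnth_enum m) /t /= -map_comp; apply: eq_map => i /=.
  by rewrite inordK ?ltnS ?mN // /fun_of_multinom.
have st : sorted geq (map val t) by rewrite tE.
by exists (exist _ t st); apply/val_inj/val_inj.
Qed.

Definition rel_gen : k.-tuple P := [tuple complete_pol R k (N + i.+1) - a i | i < k].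

(** The [i]-th indeterminate stands for the [i]-th generator and gets the degree of its complete
    homogeneous part as weight. *)
Definition shifted_weight (N : nat) (m : 'X_{1..k}) : nat := (\sum_i m i * (N + i.+1))%N.

(** Each [c l] is a polynomial in [k] new indeterminates, for which the generators are substituted;
    the weight is bounded before substitution, so only finitely many products $g^\mu m_\lambda$
    occur for a given [d]. *)
Definition spanned (d : nat) (f : P) : Prop :=
  exists2 c : box_partition k n -> P,
    forall l m, m \in msupp (c l) -> (mdeg (box_mnm l) + shifted_weight N m <= d)%N
  & f = \sum_l (c l \mPo rel_gen) * monomial_pol R (parts l).

Lemma spanned0 d : spanned d 0.
Proof.
exists (fun=> 0); first by move=> l m; rewrite msupp0.
by rewrite big1 // => l _; rewrite comp_mpoly0 mul0r.
Qed.

Lemma spannedD d f1 f2 : spanned d f1 -> spanned d f2 -> spanned d (f1 + f2).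
Proof.
move=> [c1 w1 ->] [c2 w2 ->]; exists (fun l => c1 l + c2 l).
  by move=> l m /msuppD_le; rewrite mem_cat => /orP[/w1|/w2].
by rewrite -big_split; apply: eq_bigr => l _; rewrite comp_mpolyD mulrDl.
Qed.

Lemma spannedZ d b f : spanned d f -> spanned d (b *: f).
Proof.
move=> [c w ->]; exists (fun l => b *: c l).
  by move=> l m /msuppZ_le /w.
by rewrite scaler_sumr; apply: eq_bigr => l _; rewrite comp_mpolyZ scalerAl.
Qed.

Lemma spanned_sum d (I : finType) (F : I -> P) :
  (forall i, spanned d (F i)) -> spanned d (\sum_i F i).
Proof.
by move=> sF; elim/big_ind: _ => //; [apply: spanned0 | apply: spannedD].
Qed.

Lemma spannedS d e f : (e <= d)%N -> spanned e f -> spanned d f.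
Proof. by move=> ed [c w ->]; exists c => // l m /w/leq_trans; apply. Qed.

Lemma spanned_gen d e (i : 'I_k) f : (e + (N + i.+1) <= d)%N -> spanned e f ->
  spanned d ((complete_pol R k (N + i.+1) - a i) * f).
Proof.
move=> ed [c w ->]; exists (fun l => 'X_i * c l); last first.
  rewrite mulr_sumr; apply: eq_bigr => l _; rewrite rmorphM /= comp_mpolyXU mulrA.
  by rewrite -tnth_nth tnth_mktuple.
move=> l m; rewrite mulrC (perm_mem (msuppMX _ _)) => /mapP[m' /w le ->].
apply: leq_trans ed; apply: leq_trans (leq_add le (leqnn _)).
rewrite -addnA leq_add2l /shifted_weight.
under eq_bigr => j _ do rewrite mnmDE mulnDl.
rewrite big_split /= addnC leq_add2l (bigD1 i) //= big1.
  by rewrite mnm1E eqxx mul1n addn0.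
by move=> j ne; rewrite mnm1E eq_sym (negbTE ne).
Qed.

Lemma spanned_monomial l : spanned (mdeg (box_mnm l)) (monomial_pol R (parts l)).
Proof.
exists (fun l' => (l' == l)%:R%:MP).
  move=> l' m; case: (l' =P l) => [->|_]; last by rewrite mpolyC0 msupp0.
  rewrite msupp1 inE => /eqP ->; rewrite /shifted_weight big1 ?addn0 // => i _.
  by rewrite mnm0E.
rewrite (bigD1 l) //= eqxx comp_mpolyC mul1r big1 ?addr0 // => l' /negbTE ->.
by rewrite comp_mpolyC mpolyC0 mul0r.
Qed.

Lemma sym_spanned f : f \is symmetric -> spanned (mdeg (mlead f)) f.
Proof.
move: {2}(mlead f) (erefl (mlead f)) => m; move: m f; apply: ltmwf => m IH f lf sf.
(* The induction hypothesis is put into usable forms: [IHm] for a smaller leading monomial, [IHdeg]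
   for a smaller degree with the sharper weight bound. *)
have IHlt f' d : f' \is symmetric -> f' = 0 \/ ((mlead f' < m)%O /\ (mdeg (mlead f') <= d)%N) ->
    spanned d f'.
  move=> sf' [->|[lt le]]; first exact: spanned0.
  by apply: spannedS le _; apply: IH lt _ _ _.
have IHm f' : f' \is symmetric -> f' = 0 \/ (mlead f' < m)%O -> spanned (mdeg m) f'.
  move=> sf' H; apply: IHlt => //; case: H => [|lt]; [by left | right].
  by split=> //; apply/lemc_mdeg/ltW.
have IHdeg f' d : f' \is symmetric -> (msize f' <= d.+1)%N -> (d < mdeg m)%N -> spanned d f'.
  move=> sf' sz dm; apply: IHlt => //; have [->|nz] := eqVneq f' 0; [by left | right].
  move: sz; rewrite -mlead_deg // ltnS => sz; split=> //.
  by apply: lt_mdeg_ltmc; apply: leq_ltn_trans dm.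
rewrite lf; have [->|nzf] := eqVneq f 0; first exact: spanned0.
have dec := mlead_msym_sorted sf; rewrite lf in dec.
case: (pickP (fun i => (N < m i)%N)) => [i0 Ni0|mN]; last first.
  have dm : is_dominant m by apply/is_dominantP.
  have [l lm] : exists l, box_mnm l = m.
    by apply: box_mnm_surj => // i; rewrite leqNgt mN.
  have [lh ch] := mlead_monomial_pol R dm.
  have pE : monomial_pol R m = monomial_pol R (parts l) by rewrite -lm.
  rewrite -[f](subrK (mleadc f *: monomial_pol R m)).
  apply: spannedD.
    apply: IHm; last by rewrite -[X in (_ < X)%O]lf; apply: mlead_cancel (etrans lh (esym lf)) ch.
    by apply: rpredB => //; apply: rpredZ; apply: monomial_pol_sym.
  by apply: spannedZ; rewrite pE -lm; apply: spanned_monomial.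
have [c [sc dc lh ch]] := dominant_complete_ideal R dec Ni0.
set h := \sum_i _ in lh ch.
have hsym : h \is symmetric.
  by rewrite rpred_sum // => i _; rewrite rpredM // complete_pol_sym.
pose g (i : 'I_k) := (complete_pol R k (N + i.+1) - a i) * c i.
(* Each $h_{N+i+1}$ in [h] is split as $g_i + a_i$. The $g_i$ part adds to [c i] exactly the weight
   that its degree bound leaves free. *)
have -> : f = (f - mleadc f *: h) + mleadc f *: (\sum_i g i + \sum_i a i * c i).
  rewrite -big_split /= -[LHS](subrK (mleadc f *: h)); congr (_ + _ *: _).
  by apply: eq_bigr => i _; rewrite /g; ring.
apply: spannedD.
  apply: IHm; first by rewrite rpredB // rpredZ.
  by rewrite -[X in (_ < X)%O]lf; apply: mlead_cancel (etrans lh (esym lf)) ch.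
apply: spannedZ; apply: spannedD; apply: spanned_sum => i.
  rewrite /g; have [->|nzc] := eqVneq (c i) 0; first by rewrite mulr0; apply: spanned0.
  have := dc i nzc => dci.
  have szc : (0 < msize (c i))%N by rewrite lt0n msize_poly_eq0.
  apply: (@spanned_gen _ (msize (c i)).-1); first lia.
  by apply: IHdeg; [apply: sc | lia | lia].
have [->|nzc] := eqVneq (c i) 0; first by rewrite mulr0; apply: spanned0.
have := dc i nzc; have := deg_a i => dai dci.
have szc : (0 < msize (c i))%N by rewrite lt0n msize_poly_eq0.
have [->|nzM] := eqVneq (a i * c i) 0; first exact: spanned0.
have szM := msizeM_lt nzM.
(* Since $\deg a_i < N + i + 1$, the product $a_i c_i$ has degree strictly below $|m|$. *)
apply: (@spannedS _ (mdeg m).-1); first exact: leq_pred.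
have m_gt0 : (0 < mdeg m)%N by lia.
apply: IHdeg; rewrite ?prednK //; first by rewrite rpredM // sc.
lia.
Qed.

Lemma sym_spanned_msize d f : f \is symmetric -> (msize f <= d.+1)%N -> spanned d f.
Proof.
move=> sf sz; have [->|nz] := eqVneq f 0; first exact: spanned0.
by apply: spannedS (sym_spanned sf); rewrite -ltnS mlead_deg.
Qed.

End Span.

(** * Counting *)

Section Count.
Local Open Scope nat_scope.

Fixpoint seq_weight (w : nat) (s : seq nat) : nat :=
  if s is c :: r then c * w + seq_weight w.+1 r else 0.

Lemma seq_weightE w s : seq_weight w s = \sum_(i < size s) nth 0 s i * (w + i).
Proof.
elim: s w => [|c r IH] w /=; first by rewrite big_ord0.
rewrite big_ord_recl addn0 IH; congr (_ + _); apply: eq_bigr => i _ /=.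
by rewrite /bump /= addSnnS.
Qed.

Lemma seq_weight_rcons w s c : seq_weight w (rcons s c) = seq_weight w s + c * (w + size s).
Proof.
by elim: s w => [|x s IH] w /=; rewrite ?addn0 ?add0n ?IH ?addnA // addSnnS.
Qed.

Lemma seq_weight_small w s : seq_weight w s < w -> s = nseq (size s) 0.
Proof.
elim: s w => //= -[|c] r IH w; last by lia.
by rewrite mul0n add0n => lt; rewrite -(IH w.+1) // ltnW.
Qed.

(* With increasing partitions [s] in a box of width [N], this is a bijection
   onto the pairs ([s], [c]) such that [s] has a part [N] or [c > 0]; it
   witnesses b(k, N) (1 - q^N) = b(k, N - 1) (1 - q^(N + k)) for the generating
   functions b(k, N) of the partitions in a k x N box. *)
Definition box_step (N : nat) (x : seq nat * nat) : seq nat * nat :=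
  if head 0 x.1 == 0 then (rcons (behead x.1) N, x.2) else (map predn x.1, x.2.+1).

Definition in_box (k N : nat) (s : seq nat) : bool :=
  [&& size s == k, sorted leq s & all (leq^~ N) s].

(** These are the two branches of [box_step]: the smallest part is 0, or a full column can be
    removed, after which all parts are below [N]. *)
Lemma in_box_split k N s : in_box k.+1 N s ->
  (exists2 r, s = 0 :: r & in_box k N r) \/
  (exists2 r, s = map succn r & in_box k.+1 N r && all (ltn^~ N) r).
Proof.
case: s => [|[|x] r] /and3P[//= /eqP[sr] pr]; first move=> rN.
  by left; exists r => //; apply/and3P; split; rewrite ?sr ?(path_sorted pr).
case/andP=> xN rN; right.
have pos : all (leq 1) (x.+1 :: r).
  by rewrite /=; apply: sub_all (order_path_min leq_trans pr) => y; apply: leq_trans.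
have sE : x.+1 :: r = map succn (map predn (x.+1 :: r)).
  rewrite -map_comp -[LHS]map_id; apply/eq_in_map => y /(allP pos) /= y0.
  by rewrite prednK.
exists (map predn (x.+1 :: r)); first exact: sE.
have lt : all (ltn^~ N) (map predn (x.+1 :: r)).
  rewrite all_map; apply/allP => y yr /=.
  have : y <= N by apply: (allP (_ : all (leq^~ N) (x.+1 :: r))); rewrite //= xN.
  have := allP pos _ yr.
  by case: y {yr}.
rewrite lt andbT; apply/and3P; split; first by rewrite size_map /= sr.
  by apply: (homo_sorted (e := leq)); first by move=> y z /=; lia.
by apply: sub_all lt => y /ltnW.
Qed.

Lemma in_box_rcons k N r : in_box k N r -> in_box k.+1 N (rcons r N).
Proof.
case/and3P=> /eqP sr srt rN; apply/and3P; split; first by rewrite size_rcons sr.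
  case: r srt rN {sr} => // x r pr rN; rewrite rcons_cons /= rcons_path.
  by apply/andP; split=> //; apply: (allP rN); rewrite mem_last.
by rewrite all_rcons leqnn.
Qed.

Lemma box_step0 N r c : box_step N (0 :: r, c) = (rcons r N, c).
Proof. by []. Qed.

Lemma box_stepS k N r c : in_box k.+1 N r -> box_step N (map succn r, c) = (r, c.+1).
Proof.
by case: r => // x r _; rewrite /box_step /= -map_comp map_id_in.
Qed.

Lemma box_step_in k N x : in_box k.+1 N x.1 -> in_box k.+1 N (box_step N x).1.
Proof.
case: x => s c /= /in_box_split[[r -> /in_box_rcons //]|[r -> /andP[rb _]]].
by rewrite (box_stepS _ rb).
Qed.

Lemma sumn_succ r : sumn (map succn r) = sumn r + size r.
Proof. by elim: r => //= x r ->; lia. Qed.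

(** One branch replaces a part 0 by [N]; the other loses $k+1$ from the partition and gains $N+k+1$
    from the counter. *)
Lemma box_step_weight k N x : in_box k.+1 N x.1 ->
  sumn (box_step N x).1 + (box_step N x).2 * (N + k.+1) = sumn x.1 + x.2 * (N + k.+1) + N.
Proof.
case: x => s c /= /in_box_split[[r -> _]|[r -> /andP[rb _]]].
  by rewrite box_step0 /= sumn_rcons addnAC.
rewrite (box_stepS _ rb) /= sumn_succ; case/and3P: rb => /eqP -> _ _; lia.
Qed.

(** The branch can be read off the result: the first leaves a part [N], the second only parts below
    [N]. *)
Lemma box_step_inj k N x y : in_box k.+1 N x.1 -> in_box k.+1 N y.1 ->
  box_step N x = box_step N y -> x = y.
Proof.
case: x y => s c [t e] /= /in_box_split[[r -> rb]|[r -> /andP[rb rN]]]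
  /in_box_split[[u -> ub]|[u -> /andP[ub uN]]];
  rewrite ?box_step0 ?(box_stepS _ rb) ?(box_stepS _ ub).
- by case=> /rcons_inj[-> ] ->.
- by case=> E _; move: uN; rewrite -E all_rcons /= ltnn.
- by case=> E _; move: rN; rewrite E all_rcons /= ltnn.
by case=> -> ->.
Qed.

Lemma iter_box_step_in k N s c : in_box k.+1 N s ->
  in_box k.+1 N (iter c (box_step N) (s, 0)).1.
Proof. by move=> sb; elim: c => //= c; apply: box_step_in. Qed.

Lemma iter_box_step_weight k N s c : in_box k.+1 N s ->
  let x := iter c (box_step N) (s, 0) in
  sumn x.1 + x.2 * (N + k.+1) = sumn s + c * N.
Proof.
move=> sb; elim: c => [|c IH] /=; first by rewrite !addn0.
rewrite (box_step_weight (k := k)) ?iter_box_step_in // IH mulSn; lia.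
Qed.

(** A pair with counter 0 and parts at most [N] is not a value of the step of width $N+1$, so the
    two iterations can be undone in parallel and must stop together. *)
Lemma iter_box_step_inj k N s t c e :
    in_box k.+1 N.+1 s -> in_box k.+1 N.+1 t -> all (leq^~ N) s -> all (leq^~ N) t ->
  iter c (box_step N.+1) (s, 0) = iter e (box_step N.+1) (t, 0) -> s = t /\ c = e.
Proof.
have no_step u v f : in_box k.+1 N.+1 u -> in_box k.+1 N.+1 v -> all (leq^~ N) u ->
    (u, 0) <> iter f.+1 (box_step N.+1) (v, 0).
  move=> ub vb uN; rewrite iterS; have := iter_box_step_in f vb.
  case: (iter _ _ _) => w g /= /in_box_split[[r -> rb]|[r -> /andP[rb _]]].
    by rewrite box_step0 => -[E _]; move: uN; rewrite E all_rcons /= ltnn.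
  by rewrite (box_stepS _ rb).
move=> sb tb sN tN; elim: c e => [|c IH] [|e] E.
- by case: E.
- by case: (no_step s t e sb tb sN E).
- by case: (no_step t s c tb sb tN (esym E)).
case: (IH e) => [|-> ->//].
exact: (@box_step_inj k N.+1 _ _ (iter_box_step_in c sb) (iter_box_step_in e tb) E).
Qed.

Definition box_weighted (k N d : nat) (x : seq nat * seq nat) : bool :=
  [&& in_box k N x.1, size x.2 == k & sumn x.1 + seq_weight N.+1 x.2 <= d].

(** Induction on $d - N$: the box is widened by one column, and the multiplicities of weights $N+1,
    \ldots, N+k$ are traded for multiplicities of weights $N+2, \ldots, N+k+1$. *)
Lemma box_weighted_inj k N d :
  exists2 F : seq nat * seq nat -> seq nat,
    {in box_weighted k N d &, injective F} &
    forall x, box_weighted k N d x ->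
      [&& size (F x) == k, sorted leq (F x) & sumn (F x) <= d].
Proof.
move: {2}(d - N) (erefl (d - N)) => D; elim: D N => [|D IH] N dN.
  (* Now $d \le N$, so every weight exceeds [d] and all multiplicities are 0. *)
  exists fst => [[s m] [t p]|[s m]].
    have small u w : box_weighted k N d (u, w) -> w = nseq k 0.
      case/and3P=> /= _ /eqP <- le; apply: (@seq_weight_small N.+1).
      by rewrite ltnS (leq_trans _ (_ : d <= N)) ?(leq_trans _ le) ?leq_addl // -subn_eq0 dN.
    by move=> /small -> /small -> /= ->.
  by case/and3P=> /= /and3P[-> -> _] _ le; apply: leq_trans le; apply: leq_addr.
case: k IH => [|k] IH.
  exists (fun=> [::]) => // -[s m] [t p].
  by case/and3P=> /= /and3P[/nilP -> _ _] /nilP -> _ /and3P[/= /and3P[/nilP -> _ _] /nilP ->].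
have [F injF domF] := IH N.+1 (ltac:(lia)).
(* The multiplicity of weight $N+1$ becomes the number of box steps; the final counter is the
   multiplicity of the new largest weight. *)
pose step (x : seq nat * seq nat) :=
  let y := iter (head 0 x.2) (box_step N.+1) (x.1, 0) in (y.1, rcons (behead x.2) y.2).
have widen s : in_box k.+1 N s -> in_box k.+1 N.+1 s.
  by case/and3P=> ss srt sN; apply/and3P; split=> //; apply: sub_all sN => i; apply: leqW.
have step_dom x : box_weighted k.+1 N d x -> box_weighted k.+1 N.+1 d (step x).
  case: x => s [|c m] /and3P[/= /widen sb // /eqP[sm] le].
  have := iter_box_step_in c sb; have /= := iter_box_step_weight c sb.
  rewrite /step /=; case: (iter _ _ _) => u e /= wE ub.
  rewrite /box_weighted /= ub size_rcons sm eqxx seq_weight_rcons sm /=.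
  by apply: leq_trans le; lia.
exists (F \o step) => [x y dx dy /= E|x dx]; last exact: domF (step_dom x dx).
have := injF _ _ (step_dom x dx) (step_dom y dy) E.
case: x y dx dy {E} => s [|c m] [t [|e p]] /and3P[/= sb // _ _] /and3P[/= tb // _ _].
rewrite /step /= => -[E1 /rcons_inj[-> E2]].
have E : iter c (box_step N.+1) (s, 0) = iter e (box_step N.+1) (t, 0).
  by rewrite [LHS]surjective_pairing [RHS]surjective_pairing E1 E2.
have sN : all (leq^~ N) s by case/and3P: sb.
have tN : all (leq^~ N) t by case/and3P: tb.
by have [-> ->] := iter_box_step_inj (widen _ sb) (widen _ tb) sN tN E.
Qed.

End Count.

(** * Independence *)

(** Over a nonzero commutative ring a right inverse of [D] forces $m \le n$, so the matrices are
    square. *)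
Lemma mulmx1C_leq (R : comNzRingType) m n (D : 'M[R]_(m, n)) (C : 'M[R]_(n, m)) :
  (n <= m)%N -> D *m C = 1%:M -> C *m D = 1%:M.
Proof.
move=> nm DC; have e : m = n by apply/eqP; rewrite eqn_leq nm (mulmx1_min DC).
by case: n / e D C DC {nm} => D C; apply: mulmx1C.
Qed.

Section Independence.
Variables (R : comNzRingType) (k n : nat).
Local Notation P := {mpoly R[k]}.
Local Notation N := (n - k)%N.

Definition box_weight (x : box_partition k n * 'X_{1..k}) : nat :=
  (mdeg (box_mnm x.1) + shifted_weight N x.2)%N.

(** The degree bound on the exponent makes the type finite; all weights being positive, it excludes
    no pair of weight at most [d]. *)
Definition weighted_box d : {set box_partition k n * 'X_{1..k < d.+1}} :=
  [set x | box_weight (x.1, bmnm x.2) <= d]%N.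

Definition dominant_set d : {set 'X_{1..k < d.+1}} := [set m | is_dominant (bmnm m)].

Lemma shifted_weight_seq (m : 'X_{1..k}) : shifted_weight N m = seq_weight N.+1 m.
Proof.
rewrite seq_weightE /shifted_weight size_tuple; apply: eq_bigr => i _.
by rewrite addSnnS (mnm_nth 0%N).
Qed.

Lemma mdeg_shifted_weight (m : 'X_{1..k}) : (mdeg m <= shifted_weight N m)%N.
Proof.
by rewrite mdegE /shifted_weight; apply: leq_sum => i _; rewrite leq_pmulr // addnS.
Qed.

Lemma card_weighted_box d : (#|weighted_box d| <= #|dominant_set d|)%N.
Proof.
have [F injF domF] := box_weighted_inj k N d.
pose enc (x : box_partition k n * 'X_{1..k < d.+1}) : seq nat * seq nat :=
  (rev (box_mnm x.1), tval (multinom_val x.2)).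
have enc_inj : injective enc.
  move=> [l m] [l' m'] [/(can_inj revK) El Em]; congr pair.
    by apply/val_inj/val_inj/(inj_map val_inj).
  by apply/val_inj/val_inj/val_inj.
have enc_dom x : x \in weighted_box d -> enc x \in box_weighted k N d.
  rewrite inE /box_weight => xd; rewrite /enc; apply/and3P; split=> /=.
  - apply/and3P; split; first by rewrite size_rev size_tuple.
      rewrite rev_sorted; exact: (valP x.1).
    rewrite all_rev; apply/(all_nthP 0%N) => i; rewrite size_tuple => ik.
    by have := box_mnm_le x.1 (Ordinal ik); rewrite (mnm_nth 0%N).
  - by rewrite size_tuple.
  by rewrite sumn_rev sumnE -shifted_weight_seq.
(* The default [bm0] is never reached on sequences of length [k] and sum at most [d]. Reversal turns
   increasing sequences into dominant exponents. *)
pose dec (s : seq nat) : 'X_{1..k < d.+1} :=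
  insubd bm0 [multinom nth 0%N (rev s) i | i < k].
have decE s : size s = k -> (sumn s <= d)%N ->
    tval (multinom_val (dec s)) = rev s.
  move=> ss sd.
  have E : tval (multinom_val [multinom nth 0%N (rev s) i | i < k]) = rev s.
    apply: (@eq_from_nth _ 0%N); first by rewrite size_tuple size_rev.
    move=> i; rewrite size_tuple => ik; rewrite -[i]/(nat_of_ord (Ordinal ik)).
    by rewrite -tnth_nth tnth_mktuple.
  rewrite val_insubd /= ifT // /mdeg E.
  by rewrite -sumnE sumn_rev ltnS.
rewrite -(card_in_imset (f := dec \o F \o enc)).
  apply/subset_leq_card/subsetP => _ /imsetP[x /enc_dom/domF/and3P[/eqP sF srt le] ->].
  by rewrite inE /is_dominant decE // rev_sorted.
move=> x y /enc_dom xd /enc_dom yd /= E; apply/enc_inj/injF => //.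
have /and3P[/eqP sx _ lx] := domF _ xd; have /and3P[/eqP sy _ ly] := domF _ yd.
by apply: (can_inj revK); rewrite -(decE _ sx lx) -(decE _ sy ly) E.
Qed.

Variable a : 'I_k -> P.
Hypothesis sym_a : forall i, a i \is symmetric.
Hypothesis deg_a : forall i : 'I_k, (msize (a i) <= N + i.+1)%N.
Local Notation gen := (rel_gen n a).

Definition weighted_prod d (x : box_partition k n * 'X_{1..k < d.+1}) : P :=
  ('X_[x.2] \mPo gen) * monomial_pol R (parts x.1).

Lemma spanned_weighted_box d (c : box_partition k n -> P) :
    (forall l m, m \in msupp (c l) -> (box_weight (l, m) <= d)%N) ->
  \sum_l (c l \mPo gen) * monomial_pol R (parts l) =
  \sum_(x in weighted_box d) (c x.1)@_(x.2) *: weighted_prod x.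
Proof.
move=> cd.
transitivity (\sum_l \sum_(m : 'X_{1..k < d.+1})
    (if (l, m) \in weighted_box d then (c l)@_m *: weighted_prod (l, m) else 0)); last first.
  by rewrite pair_bigA [RHS]big_mkcond; apply: eq_bigr => -[l m] _.
apply: eq_bigr => l _.
have sz : (msize (c l) <= d.+1)%N.
  rewrite msizeE; apply/bigmax_leqP_seq => m /cd le _; rewrite ltnS.
  apply: leq_trans le; apply: leq_trans (leq_addl _ _).
  exact: mdeg_shifted_weight.
rewrite {1}(mpolywE sz) raddf_sum mulr_suml; apply: eq_bigr => m _ /=.
rewrite comp_mpolyZ -scalerAl inE /=; case: ifPn => // nle.
rewrite memN_msupp_eq0 ?scale0r //; apply: contra nle; exact: cd.
Qed.

(** [D] expresses the monomial symmetric polynomials in the products, and [C] lists the coefficients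
    of the products at dominant monomials. Then [D *m C] is the identity, by counting so is
    [C *m D], and a linear relation is a row killed by [C]. *)
Lemma weighted_prod_free d (c : box_partition k n * 'X_{1..k < d.+1} -> R) :
    \sum_(x in weighted_box d) c x *: weighted_prod x = 0 ->
  forall x, x \in weighted_box d -> c x = 0.
Proof.
move=> c0.
pose A := #|dominant_set d|; pose B := #|weighted_box d|.
pose dm (i : 'I_A) : 'X_{1..k} := bmnm (enum_val i).
pose bx (j : 'I_B) : box_partition k n * 'X_{1..k < d.+1} := enum_val j.
have dmP i : is_dominant (dm i) by have := enum_valP i; rewrite inE.
have sp (i : 'I_A) : exists e : 'I_B -> R,
    monomial_pol R (dm i) = \sum_j e j *: weighted_prod (bx j).
  have [||e ew eE] := @sym_spanned_msize R k n a sym_a deg_a d (monomial_pol R (dm i)).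
  - exact: monomial_pol_sym.
  - have [lm cm] := mlead_monomial_pol R (dmP i).
    rewrite -mlead_deg ?lm ?bmdeg //.
    by rewrite -mleadc_eq0 cm oner_eq0.
  rewrite eE (spanned_weighted_box (d := d) (c := e)) //.
  exists (fun j => (e (bx j).1)@_(bmnm (bx j).2)).
  by rewrite big_enum_val.
have [e eE] : exists e : 'I_A -> 'I_B -> R, forall i,
    monomial_pol R (dm i) = \sum_j e i j *: weighted_prod (bx j).
  exact: fin_all_exists sp.
pose D : 'M[R]_(A, B) := \matrix_(i, j) e i j.
pose C : 'M[R]_(B, A) := \matrix_(j, i) (weighted_prod (bx j))@_(dm i).
have DC : D *m C = 1%:M.
  apply/matrixP => i i'; rewrite !mxE.
  transitivity ((monomial_pol R (dm i))@_(dm i')).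
    rewrite eE raddf_sum.
    by apply: eq_bigr => j _ /=; rewrite !mxE mcoeffZ.
  rewrite mcoeff_monomial_pol; congr (nat_of_bool _)%:R.
  apply/idP/eqP => [pm|-> //]; apply/enum_val_inj/val_inj/esym.
  exact: is_dominant_perm_inj (dmP _) (dmP _) pm.
have CD := mulmx1C_leq (card_weighted_box d) DC.
pose v : 'rV[R]_B := \row_j c (bx j).
have vC : v *m C = 0.
  apply/rowP => i; rewrite !mxE.
  transitivity ((\sum_(x in weighted_box d) c x *: weighted_prod x)@_(dm i)).
    rewrite raddf_sum [RHS]big_enum_val.
    by apply: eq_bigr => j _ /=; rewrite !mxE mcoeffZ.
  by rewrite c0 mcoeff0.
have v0 : v = 0 by rewrite -[v]mulmx1 -CD mulmxA vC mul0mx.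
move=> x xB; have := congr1 (fun u : 'rV[R]_B => u 0 (enum_rank_in xB x)) v0.
by rewrite !mxE /bx enum_rankK_in.
Qed.

Lemma comp_box_free (c : box_partition k n -> P) :
  \sum_l (c l \mPo gen) * monomial_pol R (parts l) = 0 -> forall l, c l = 0.
Proof.
move=> c0 l.
(* Large enough for every pair that occurs in the relation. *)
pose d := (\max_l \max_(m <- msupp (c l)) box_weight (l, m))%N.
have cd l' m : m \in msupp (c l') -> (box_weight (l', m) <= d)%N.
  move=> mc; apply: (bigop.bigmax_sup l') => //.
  by apply: (bigop.leq_bigmax_seq (F := fun m => box_weight (l', m))).
rewrite (spanned_weighted_box cd) in c0.
have {}c0 := weighted_prod_free (c := fun x => (c x.1)@_(x.2)) c0.
apply/mpolyP => m; rewrite mcoeff0; apply/eqP; rewrite mcoeff_eq0; apply/negP => mc.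
have md : (mdeg m < d.+1)%N.
  rewrite ltnS; apply: leq_trans (cd _ _ mc); apply: leq_trans (leq_addl _ _).
  exact: mdeg_shifted_weight.
have := c0 (l, BMultinom md); rewrite inE /= (cd _ _ mc) => /(_ isT)/eqP.
by rewrite mcoeff_eq0 mc.
Qed.

End Independence.

(** * Passage to the quotient *)

(** Every nonconstant monomial contains some indeterminate, whose image [tnth g i] is factored out;
    the cofactor is a polynomial in symmetric polynomials. Hence only the constant term survives
    modulo the ideal. *)
Lemma comp_mpoly_const_part (R : comNzRingType) k r (g : r.-tuple {mpoly R[k]})
    (p : {mpoly R[r]}) : (forall i, tnth g i \is symmetric) ->
  exists2 q : 'I_r -> {mpoly R[k]}, (forall i, q i \is symmetric) &
    p \mPo g = (p@_0%MM)%:MP + \sum_i q i * tnth g i.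
Proof.
move=> sg; elim/mpolyind: p => [|c m p _ _ [q sq qE]].
  exists (fun=> 0); first by move=> i; apply: rpred0.
  by rewrite comp_mpoly0 mcoeff0 mpolyC0 add0r big1 // => i _; rewrite mul0r.
rewrite comp_mpolyD comp_mpolyZ qE mcoeffD mpolyCD mcoeffZ mcoeffX.
case: (pickP (fun i => m i != 0%N)) => [i mi|m0].
  have Um : (U_(i) <= m)%MM by rewrite lep1mP.
  pose t := 'X_[m - U_(i)] \mPo g.
  exists (fun j => (if j == i then c *: t else 0) + q j).
    move=> j; rewrite rpredD //; case: ifP => _; last exact: rpred0.
    by rewrite rpredZ // mcomp_sym // => l; rewrite -tnth_nth.
  have -> : (m == 0%MM) = false by apply: contraNF mi => /eqP ->; rewrite mnm0E.
  rewrite mulr0 mpolyC0 add0r addrCA; congr (_ + _).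
  under [in RHS]eq_bigr => j _ do rewrite mulrDl.
  rewrite big_split /=; congr (_ + _).
  rewrite (bigD1 i) //= eqxx big1 ?addr0; last by move=> j /negbTE ->; rewrite mul0r.
  rewrite -scalerAl; congr (_ *: _).
  by rewrite -{1}(submK Um) mpolyXD rmorphM /= comp_mpolyXU -tnth_nth.
exists q => //.
have -> : m = 0%MM by apply/mnmP => i; rewrite mnm0E; apply/eqP; have := m0 i; case: eqP.
by rewrite mpolyX0 comp_mpoly1 eqxx mulr1 addrA alg_mpolyC.
Qed.

Theorem theorem9p11 (R : comNzRingType) (k n : nat) (le_kn : (k <= n)%N)
    (a : 'I_k -> {sympoly R[k]})
    (deg_a : forall i : 'I_k, degree_lt (a i) (n - k + i.+1)) :
  is_basis (M := quot_by (fun i : 'I_k => complete R k (n - k + i.+1) - a i))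
    (fun l : box_partition k n => residue _ (monomial R (parts l))).
Proof.
pose a' i : {mpoly R[k]} := a i.
have sym_a i : a' i \is symmetric by rewrite /a'; case: (a i).
set g := (fun i : 'I_k => _ - _).
have gE i : (g i : {mpoly R[k]}) = tnth (rel_gen n a') i by rewrite tnth_mktuple.
have residue0 : residue g 0 = 0 by rewrite -{1}(subr0 0) residueB subrr.
have residue_sum (c : box_partition k n -> R) :
    \sum_l c l *: residue g (monomial R (parts l)) =
    residue g (\sum_l c l *: monomial R (parts l)).
  rewrite (big_morph (residue g) (residueD g) residue0).
  by apply: eq_bigr => l _; apply: residueZ.
have sympol_sum (I : finType) (F : I -> {sympoly R[k]}) :
    sympol (\sum_i F i) = \sum_i sympol (F i) by exact: (big_morph (@sympol R k)).
split=> [c|x].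
  rewrite residue_sum => c0.
  have : residue g (\sum_l c l *: monomial R (parts l)) == residue g 0.
    by apply/eqP; rewrite residue0.
  rewrite residue_eq subr0 => /ideal_genP[f fE] l.
  have sp i : exists e : box_partition k n -> {mpoly R[k]},
      (f i : {mpoly R[k]}) = \sum_l (e l \mPo rel_gen n a') * monomial_pol R (parts l).
    have [|e _ eE] := @sym_spanned R k n a' sym_a deg_a (f i); last by exists e.
    by case: (f i).
  have [e eE] := fin_all_exists sp.
  (* The equation $\sum_l c_l m_l = \sum_i f_i g_i$, with each $f_i$ expanded over the box, becomes
     a relation with coefficients [d l]. Independence gives [d l = 0], and the constant term of
     [d l] is [c l]. *)
  pose d l := (c l)%:MP - \sum_i 'X_i * e i l.
  have d0 : \sum_l (d l \mPo rel_gen n a') * monomial_pol R (parts l) = 0.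
    under eq_bigr => l' _ do rewrite /d rmorphB /= comp_mpolyC mulrBl raddf_sum mulr_suml.
    rewrite sumrB exchange_big /=; apply/eqP; rewrite subr_eq0; apply/eqP.
    have := congr1 (@sympol R k) fE; rewrite !sympol_sum => E.
    transitivity (\sum_l c l *: monomial_pol R (parts l)).
      by apply: eq_bigr => l' _; rewrite mul_mpolyC.
    rewrite [LHS]E; apply: eq_bigr => i _.
    transitivity ((f i : {mpoly R[k]}) * g i) => //.
    rewrite (eE i) gE mulr_suml; apply: eq_bigr => l' _.
    by rewrite rmorphM /= comp_mpolyXU -tnth_nth mulrC mulrA.
  have := comp_box_free sym_a deg_a d0 l; rewrite /d => /eqP; rewrite subr_eq0 => /eqP.
  move/(congr1 (mcoeff 0%MM)); rewrite mcoeffC eqxx mulr1 => ->.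
  rewrite raddf_sum big1 // => i _ /=.
  apply: memN_msupp_eq0; rewrite mulrC (perm_mem (msuppMX _ _)).
  by apply/mapP => -[m _ /esym/eqP]; rewrite mnmD_eq0 mnm1_eq0.
(* Generation: [f] is expanded over the box, and each coefficient $e_l(g)$ is reduced to its
   constant term. *)
have [f ->] := residueP x.
have [|e _ eE] := @sym_spanned R k n a' sym_a deg_a f; first by case: f.
have sp l : exists q : 'I_k -> {sympoly R[k]},
   e l \mPo rel_gen n a' = ((e l)@_0%MM)%:MP + \sum_i (q i : {mpoly R[k]}) * g i.
  have [|q sq ->] := @comp_mpoly_const_part R k k (rel_gen n a') (e l).
    by move=> i; rewrite -gE; case: (g i).
  by exists (fun i => Sympoly (sq i)); congr (_ + _); apply: eq_bigr => i _; rewrite gE.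
have [q qE] := fin_all_exists sp.
exists (fun l => (e l)@_0%MM); rewrite residue_sum; apply/eqP; rewrite residue_eq.
apply/ideal_genP; exists (fun i => \sum_l q l i * monomial R (parts l)).
apply: val_inj.
transitivity ((f : {mpoly R[k]}) - \sum_l sympol ((e l)@_0%MM *: monomial R (parts l))).
  by rewrite -sympol_sum.
rewrite eE -sumrB [RHS]sympol_sum.
transitivity (\sum_l \sum_i sympol (q l i) * (g i : {mpoly R[k]}) * monomial_pol R (parts l)).
  by apply: eq_bigr => l _; rewrite qE mulrDl mul_mpolyC addrC addKr mulr_suml.
rewrite exchange_big; apply: eq_bigr => i _ /=.
transitivity (sympol (\sum_l q l i * monomial R (parts l)) * (g i : {mpoly R[k]})) => //.
by rewrite sympol_sum mulr_suml; apply: eq_bigr => l _; rewrite mulrAC.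
Qed.
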